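(* Let $(X,|\cdot|)$ be a compact metric space, let $B\subset X^2\setminus\Delta$ satisfy (a) $(y,y')\in B\Leftrightarrow(y',y)\in B$ and (b) $B_t=\{(y,y')\in B:|yy'|\ge t\}$ is finite for each $t>0$, and let $M=M(B)$ be the associated spectral triple. Assume that its density $D=\mathrm{dens}(M)$ satisfies $D>2$. Then for every $x,x'\in X$ $$|xx'|\le|xx'|_M\le\frac{D+2}{D-2}\,|xx'|,$$ where $|\cdot|_M$ is the Connes metric associated with $M$. Moreover, $|yy'|=|yy'|_M$ for each $(y,y')\in B$.
   Context: $|xy|$ is the distance in $X$; $\Delta\subset X^2$ is the diagonal; for $z=(x,y)\in X^2$ write $|z|=|xy|$; $X^2$ carries the metric $|zz'|=\max\{|xx'|,|yy'|\}$ for $z=(x,y)$, $z'=(x',y')$. Density: $\mathrm{dens}(M(B))=\mathrm{dens}(B)=\inf_{z\in X^2\setminus\Delta}\sup_{b\in B}|z|/|zb|$, where $|z|/0=\infty$; if $D=\infty$ (possible only for finite $X$), $(D+2)/(D-2)$ is read as $1$. Spectral triple $M(B)=\{\mathcal A,\mathcal H,ds\}$: $\mathcal H=\ell^2(B)$ (square-summable functions $\xi:B\to\mathbb C$); $\mathcal A$ is the algebra of complex-valued Lipschitz functions on $X$, represented by $(\pi(a)\xi)(y,y')=a(y)\xi(y,y')$; and $(ds\,\xi)(y,y')=|yy'|\,\xi(y',y)$. The Dirac operator is $\mathcal D=ds^{-1}$, and $\|[\mathcal D,\pi(a)]\|=\sup_{(y,y')\in B}|a(y)-a(y')|/|yy'|$.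 The Connes metric is $|xx'|_M=\sup\{|a(x)-a(x')|: a\in\mathcal A,\ \|[\mathcal D,\pi(a)]\|\le1\}$. *)

(* Defs.v *)
From HB Require Import structures.
From mathcomp Require Import all_boot all_order all_algebra.
From mathcomp Require Import complex.
From mathcomp Require Import all_classical all_reals all_analysis.

Set Implicit Arguments.
Unset Strict Implicit.
Unset Printing Implicit Defensive.

Import Order.TTheory GRing.Theory Num.Theory.
Import ComplexField.Normc.

Local Open Scope classical_set_scope.
Local Open Scope ring_scope.
Local Open Scope complex_scope.

Section SpectralTriple.
Context {R : realType} {X : metricType R}.

Definition len (z : X * X) : R := mdist z.1 z.2.

(* MathComp-Analysis puts no metricType structure on products. *)
Definition dist2 (z z' : X * X) : R :=
  Num.max (mdist z.1 z'.1) (mdist z.2 z'.2).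

(* |z| / |zb|, with |z| / 0 = +oo *)
Definition ratio (z b : X * X) : \bar R :=
  if dist2 z b == 0 then +oo%E else (len z / dist2 z b)%:E.

(* For empty B (and X with at least two points) the inner supremum, hence the
   density, is -oo rather than 0; neither value exceeds 2. *)
Definition dens (B : set (X * X)) : \bar R :=
  ereal_inf [set ereal_sup [set ratio z b | b in B] | z in ~` diagonal].

(* (D + 2) / (D - 2), read as 1 when D = +oo; only used for D > 2. *)
Definition distortion (D : \bar R) : \bar R :=
  if D is r%:E then ((r + 2) / (r - 2))%:E else 1%E.

Definition lipschitz_alg : set (X -> R[i]) :=
  [set a | exists k : R, forall x x', normc (a x - a x') <= k * mdist x x'].

(* Functions on B are represented by functions on X * X vanishing off B. *)
Definition l2norm (B : set (X * X)) (xi : X * X -> R[i]) : \bar R :=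
  sqrte (\esum_(z in B) (normc (xi z) ^+ 2)%:E).

Definition l2 (B : set (X * X)) : set (X * X -> R[i]) :=
  [set xi | (forall z, ~ B z -> xi z = 0) /\ (l2norm B xi < +oo)%E].

Definition rep (a : X -> R[i]) (xi : X * X -> R[i]) : X * X -> R[i] :=
  fun z => a z.1 * xi z.

Definition ds (xi : X * X -> R[i]) : X * X -> R[i] :=
  fun z => (len z)%:C * xi (z.2, z.1).

(* Graph of the unbounded operator D = ds^-1 on l2 B: its domain is the range
   of ds. *)
Definition dirac (B : set (X * X)) (xi eta : X * X -> R[i]) : Prop :=
  [/\ l2 B xi, l2 B eta & ds eta = xi].

(* Operator norm of [D, rep a], on the vectors xi such that both xi and
   rep a xi lie in the domain of D. *)
Definition comm_norm (B : set (X * X)) (a : X -> R[i]) : \bar R :=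
  ereal_sup [set r | exists xi eta zeta : X * X -> R[i],
    [/\ (l2norm B xi <= 1)%E, dirac B xi eta, dirac B (rep a xi) zeta &
        r = l2norm B (fun z => zeta z - rep a eta z)]].

Definition connes (B : set (X * X)) (x x' : X) : \bar R :=
  ereal_sup [set (normc (a x - a x'))%:E |
    a in [set a | lipschitz_alg a /\ (comm_norm B a <= 1)%E]].

End SpectralTriple.

(* Main.v *)
(** On a pair (y, y') of B the commutator [D, a] multiplies by (a y - a y') / |yy'| up
    to the flip, so ||[D, a]|| <= 1 means exactly that a is 1-Lipschitz on the
    pairs of B.  The distance to x is such a function, whence the lower bound.
    Conversely, if a is k-Lipschitz on X and d < D, every z has a neighbour b in
    B with |zb| <= |z| / d, and going through b shows that a is Lipschitz with
    constant 1 + 2/d + 2k/d; the least Lipschitz constant therefore satisfies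
    k (d - 2) <= d + 2. *)

Require Import Defs.
From mathcomp Require Import all_boot all_order all_algebra.
From mathcomp Require Import complex lra.
From mathcomp Require Import all_classical all_reals all_analysis.

Import Order.TTheory GRing.Theory Num.Theory.
Import ComplexField.Normc.

Local Open Scope classical_set_scope.
Local Open Scope ring_scope.

Lemma normcB_sym (R : rcfType) (u v : complex R) : normc (u - v) = normc (v - u).
Proof. by rewrite -normcN opprB. Qed.

Lemma normc_real (R : rcfType) (r : R) : normc (r%:C)%C = `|r|.
Proof. by rewrite /= expr0n addr0 sqrtr_sqr. Qed.

Lemma normc_ge0 (R : rcfType) (u : complex R) : 0 <= normc u.
Proof. by case: u => a b; exact: sqrtr_ge0. Qed.

Section Connes.
Context (R : realType) (X : metricType R) (B : set (X * X)).
Context (B_offdiag : B `<=` ~` diagonal).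
Context (B_sym : forall y y' : X, B (y, y') <-> B (y', y)).

Implicit Types (a : X -> complex R) (xi eta zeta : X * X -> complex R).

Definition contracts a := forall z, B z -> normc (a z.1 - a z.2) <= len z.

Lemma len_gt0 (z : X * X) : ~ diagonal z -> 0 < len z.
Proof. by move=> zd; rewrite mdist_gt0; apply/eqP. Qed.

Lemma len_swap (z : X * X) : len (z.2, z.1) = len z.
Proof. exact: metric_sym. Qed.

Lemma len_neq0 (z : X * X) : B z -> (len z)%:C%C != 0.
Proof.
move=> Bz; have l0 := len_gt0 _ (B_offdiag _ Bz).
by apply/eqP => -[] /eqP; rewrite (gt_eqF l0).
Qed.

Lemma B_swap (z : X * X) : B z -> B (z.2, z.1).
Proof. by case: z => y y' /B_sym. Qed.

Lemma esum_swap (f : X * X -> \bar R) :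
  \esum_(z in B) f z = \esum_(z in B) f (z.2, z.1).
Proof.
apply: reindex_esum; split.
- by move=> z /B_swap.
- by move=> [u v] [u' v'] _ _ /= [-> ->].
- by move=> [u v] /B_swap Bz; exists (v, u).
Qed.

Lemma l2norm_eq0 xi z : B z -> (forall w, w <> z -> xi w = 0) ->
  l2norm B xi = (normc (xi z))%:E.
Proof.
move=> Bz xi0; rewrite /l2norm esum_mkcond.
rewrite -(eq_esum (a := fun w => if w \in [set z]
    then ((normc (xi w)) ^+ 2)%:E else 0%E)); last first.
  move=> w _; case: (pselect (w = z)) => [->|wz]; first by rewrite !mem_set.
  by rewrite xi0// normc0 expr0n !if_same.
rewrite -esum_mkcond esum_set1 ?lee_fin ?sqr_ge0//=.
by rewrite sqrtr_sqr ger0_norm// normc_ge0.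
Qed.

(** With [w] the flip of [z], the two domain conditions evaluated at [w] read [len z * eta z = xi w]
    and [len z * zeta z = a z.2 * xi w]. Subtract [a z.1] times the first from the second. *)
Lemma normc_commutator a xi eta zeta z :
  Defs.dirac B xi eta -> Defs.dirac B (rep a xi) zeta -> B z ->
  normc (zeta z - rep a eta z) * len z =
    normc (a z.1 - a z.2) * normc (xi (z.2, z.1)).
Proof.
move=> [_ _ /(congr1 (fun f => f (z.2, z.1))) /= xiE].
move=> [_ _ /(congr1 (fun f => f (z.2, z.1))) /= zetaE] Bz.
have lz := ltW (len_gt0 _ (B_offdiag _ Bz)).
rewrite -{1}(ger0_norm lz) -normc_real -!normcM mulrBl.
move: xiE zetaE; rewrite /rep /ds len_swap /= -surjective_pairing => <-.
rewrite (mulrC (zeta z)) => ->; rewrite normcB_sym.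
by congr normc; rewrite mulrBl (mulrC _%:C%C) !mulrA.
Qed.

Lemma contracts_comm_norm a : contracts a -> (comm_norm B a <= 1)%E.
Proof.
move=> ca; apply: ge_ereal_sup => _ [xi [eta [zeta [xi1 Deta Dzeta ->]]]].
apply: le_trans xi1; rewrite /l2norm lee_sqrt; last first.
  by apply: esum_ge0 => z _; rewrite lee_fin sqr_ge0.
(* The commutator at [z] sees [xi] at the flip of [z]; once the sum for [xi] is reindexed by flips,
   the comparison is termwise. *)
rewrite [leRHS]esum_swap; apply: le_esum => z Bz; rewrite lee_fin.
rewrite ler_sqr ?nnegrE ?normc_ge0//.
have lz := len_gt0 _ (B_offdiag _ Bz).
rewrite -(ler_pM2r lz) (normc_commutator _ _ _ _ _ Deta Dzeta Bz) mulrC.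
by rewrite ler_wpM2l ?normc_ge0// ca.
Qed.

(* Tested on the indicator function of the single point (y, y'), the commutator
   has norm |a y - a y'| / |yy'|. *)
Lemma comm_norm_contracts a : (comm_norm B a <= 1)%E -> contracts a.
Proof.
move=> a1 z Bz; pose w : X * X := (z.2, z.1).
pose d (u : X * X) (c : complex R) v := if v == u then c else 0.
have dz u c v : v <> u -> d u c v = 0 by rewrite /d; case: eqP.
have du u c : d u c u = c by rewrite /d eqxx.
have l2d u c : B u -> l2 B (d u c).
  move=> Bu; split; last by rewrite (l2norm_eq0 _ _ Bu (dz u c)) ltry.
  by move=> v Bv; apply: dz => vu; apply: Bv; rewrite vu.
have Bw : B w := B_swap _ Bz.
have l0 := len_neq0 _ Bz.
(* [ds] carries a point mass at [w] to one at [z], scaled by [len z]; dividing by [len z] gives the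
   preimages that put [d z 1] and [rep a (d z 1)] in the domain of the Dirac operator. *)
have dsd c : ds (d w (c / (len z)%:C%C)) = d z c.
  apply/funext => v; rewrite /ds /d.
  have -> : ((v.2, v.1) == w) = (v == z).
    by case: v {l0 a1 Bz Bw} @w => [v1 v2]; case: z => [z1 z2];
       rewrite /= !xpair_eqE andbC.
  by case: eqP => [->|_]; rewrite ?mulr0// mulrC divfK.
have repd : rep a (d z 1) = d z (a z.1).
  by apply/funext => v; rewrite /rep /d; case: eqP => [->|_]; rewrite ?mulr1 ?mulr0.
have Dxi : Defs.dirac B (d z 1) (d w (1 / (len z)%:C%C)) by split; auto.
have Drep : Defs.dirac B (rep a (d z 1)) (d w (a z.1 / (len z)%:C%C)).
  by rewrite repd; split; auto.
have := normc_commutator _ _ _ _ _ Dxi Drep Bw.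
rewrite len_swap /= -surjective_pairing (du z) normc1 mulr1 (normcB_sym _ (a z.2)) => <-.
rewrite -[leRHS]mul1r ler_wpM2r ?(ltW (len_gt0 _ (B_offdiag _ Bz)))//.
rewrite -lee_fin; apply: le_trans a1; apply: le_ereal_sup_tmp.
eexists; last exact: lexx.
exists (d z 1), (d w (1 / (len z)%:C%C)), (d w (a z.1 / (len z)%:C%C)); split => //.
  by rewrite (l2norm_eq0 _ _ Bz (dz z 1)) du normc1.
rewrite (l2norm_eq0 _ _ Bw)// => v vw.
by rewrite /rep !dz// mulr0 subr0.
Qed.

Definition lipbound a (k : R) :=
  forall x x', normc (a x - a x') <= k * mdist x x'.

Lemma mdist_le_connes x x' : ((mdist x x')%:E <= connes B x x')%E.
Proof.
pose a y : complex R := (mdist x y)%:C%C.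
have aL : lipbound a 1.
  move=> y y'; rewrite mul1r /a -rmorphB normc_real ler_norml.
  have := metric_triangle x y y'; have := metric_triangle x y' y.
  by rewrite (metric_sym y' y) => ? ?; lra.
apply: le_ereal_sup_tmp; exists (normc (a x - a x'))%:E.
  exists a => //; split; first by exists 1.
  by apply: contracts_comm_norm => z _; rewrite -[len z]mul1r.
by rewrite lee_fin normcB_sym /a mdistxx subr0 normc_real ler_norm.
Qed.

Lemma connes_le_mdist y y' : B (y, y') -> (connes B y y' <= (mdist y y')%:E)%E.
Proof.
move=> Byy'; apply: ge_ereal_sup => _ [a [_ a1] <-].
by rewrite lee_fin; exact: (comm_norm_contracts _ a1 _ Byy').
Qed.

Lemma dens_gt_near (d : R) (z : X * X) : 0 < d -> (d%:E < dens B)%E ->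
  ~ diagonal z -> exists2 b, B b & dist2 z b <= len z / d.
Proof.
move=> d0 dD zd.
have /(lt_le_trans dD) : (dens B <= ereal_sup [set Defs.ratio z b | b in B])%E.
  by apply: ereal_inf_lbound; exists z.
(* The supremum may not be attained; strictness of [d < dens B] provides a [b] whose ratio exceeds
   [d]. *)
move=> /ereal_sup_gt[_ [b Bb <-]]; rewrite /Defs.ratio.
move=> dr; exists b => //; move: dr; have [-> _|nz] := eqVneq (dist2 z b) 0.
  by rewrite divr_ge0 ?ltW// len_gt0.
have zb0 : 0 < dist2 z b.
  by rewrite lt_neqAle eq_sym nz /dist2 le_max mdist_ge0.
by rewrite lte_fin ltr_pdivlMr// ler_pdivlMr// mulrC => /ltW.
Qed.

(* Replace x, x' by a nearby pair of B, on which a contracts. *)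
Lemma lipbound_improve a (k d : R) : 0 < d -> (d%:E < dens B)%E ->
  0 <= k -> contracts a -> lipbound a k ->
  lipbound a (1 + 2 / d + 2 * k / d).
Proof.
move=> d0 dD k0 ca ak x x'.
have [<-|xx'] := eqVneq x x'; first by rewrite subrr normc0 mdistxx mulr0.
have [|[y y'] Byy'] := dens_gt_near d (x, x') d0 dD; first exact/eqP.
rewrite /dist2 /len /= ge_max => /andP[xy xy'].
set m := mdist x x' in xy xy' *.
have ayy' : normc (a y - a y') <= mdist y y' := ca _ Byy'.
have axy : normc (a x - a y) <= k * (m / d).
  by apply: le_trans (ak _ _) _; rewrite ler_wpM2l.
have axy' : normc (a y' - a x') <= k * (m / d).
  by rewrite normcB_sym; apply: le_trans (ak _ _) _; rewrite ler_wpM2l.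
(* The middle leg of the path x, y, y', x' accounts for [1 + 2 / d], the two outer legs for
   [2 * k / d]. *)
have yy' : mdist y y' <= m + 2 * (m / d).
  have := metric_triangle y x y'; have := metric_triangle x x' y'.
  by rewrite (metric_sym y x) -/m => ? ?; lra.
have -> : a x - a x' = (a x - a y) + ((a y - a y') + (a y' - a x')).
  by rewrite !subrKA.
have := le_normcD (a x - a y) ((a y - a y') + (a y' - a x')).
have := le_normcD (a y - a y') (a y' - a x').
have -> : (1 + 2 / d + 2 * k / d) * m = m + 2 * (m / d) + 2 * (k * (m / d)).
  by rewrite !mulrDl mul1r; congr (_ + _ + _); lra.
by move=> ? ?; lra.
Qed.

(** For distinct points, the difference quotient is a lower bound of all Lipschitz constants, hence
    at most their infimum. Minimality turns a single improvement step into an inequality on [k],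
    with no iteration. *)
Lemma least_lipbound a : lipschitz_alg a -> exists k : R,
  [/\ 0 <= k, lipbound a k & forall k', 0 <= k' -> lipbound a k' -> k <= k'].
Proof.
move=> [k ak]; pose E := [set k | 0 <= k /\ lipbound a k].
have E0 : E !=set0.
  (* The constant given by [lipschitz_alg] may be negative. *)
  exists `|k|; split => // x x'; apply: le_trans (ak x x') _.
  by rewrite ler_wpM2r ?mdist_ge0// ler_norm.
have Elb : has_lbound E by exists 0 => ? [].
exists (inf E); split.
- by apply: lb_le_inf => // ? [].
- move=> x x'; have [<-|xx'] := eqVneq x x'.
    by rewrite subrr normc0 mdistxx mulr0.
  have m0 : 0 < mdist x x' by rewrite mdist_gt0.
  rewrite -ler_pdivrMr//; apply: lb_le_inf => // k' [_ ak'].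
  by rewrite ler_pdivrMr.
- by move=> k' k'0 ak'; apply: ge_inf.
Qed.

(* The least Lipschitz constant [k] of a contracting [a] satisfies
   [k <= 1 + 2 / d + 2 * k / d] for all [d < dens B], which bounds [dens B] by
   [2 * (k + 1) / (k - 1)] as soon as [1 < k]. *)
Lemma contracts_lipbound a : (2%:E < dens B)%E -> lipschitz_alg a ->
  contracts a -> exists2 k : R, lipbound a k & (k%:E <= distortion (dens B))%E.
Proof.
move=> D2 /least_lipbound[k [k0 ak kmin]] ca; exists k => //.
have kd d : 0 < d -> (d%:E < dens B)%E -> k * d <= d + 2 + 2 * k.
  move=> d0 dD.
  have k'0 : 0 <= 1 + 2 / d + 2 * k / d.
    by rewrite !addr_ge0 ?divr_ge0 ?mulr_ge0// ltW.
  have := kmin _ k'0 (lipbound_improve _ _ _ d0 dD k0 ca ak).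
  rewrite -(ler_pM2r d0) !mulrDl !divfK ?gt_eqF//; lra.
case: (dens B) D2 kd => [r| |//] /=; rewrite ?lee_fin ?lte_fin => D2 kd.
- rewrite ler_pdivlMr ?subr_gt0// leNgt; apply/negP => kr.
  have k1 : 0 < k - 1 by nra.
  (* [d0] is the value of [d] at which [kd] is an equality; any admissible [d] above it, such as the
     midpoint of [d0] and [r], violates [kd]. *)
  pose d0 := 2 * (k + 1) / (k - 1).
  have d0E : d0 * (k - 1) = 2 * (k + 1) by rewrite divfK ?gt_eqF.
  have d0r : d0 < r by rewrite ltr_pdivrMr//; lra.
  have d00 : 0 < d0 by rewrite divr_gt0//; lra.
  have := kd ((d0 + r) / 2); rewrite lte_fin => kd'.
  have := kd' ltac:(lra) ltac:(lra).
  have : d0 * (k - 1) < r * (k - 1) by rewrite ltr_pM2r.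
  by lra.
(* For infinite density every positive [d] is admissible, so [d0 + 1] already contradicts
   [1 < k]. *)
- rewrite leNgt; apply/negP => k1'.
  have k1 : 0 < k - 1 by lra.
  pose d0 := 2 * (k + 1) / (k - 1).
  have d0E : d0 * (k - 1) = 2 * (k + 1) by rewrite divfK ?gt_eqF.
  have d00 : 0 < d0 by rewrite divr_gt0//; lra.
  have := kd (d0 + 1) ltac:(lra) (ltry _).
  by lra.
Qed.

Lemma connes_le_distortion x x' : (2%:E < dens B)%E ->
  (connes B x x' <= distortion (dens B) * (mdist x x')%:E)%E.
Proof.
move=> D2; apply: ge_ereal_sup => _ [a [aL /comm_norm_contracts ca] <-].
have [k ak kD] := contracts_lipbound _ D2 aL ca.
apply: (@le_trans _ _ (k%:E * (mdist x x')%:E)%E).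
  by rewrite -EFinM lee_fin.
by rewrite lee_wpmul2r ?lee_fin ?mdist_ge0.
Qed.

End Connes.

Theorem proposition2p2 (R : realType) (X : metricType R) (B : set (X * X)) :
  compact [set: X] ->
  B `<=` ~` diagonal ->
  (forall y y' : X, B (y, y') <-> B (y', y)) ->
  (forall t : R, 0 < t -> finite_set (B `&` [set z | t <= len z])) ->
  (2%:E < dens B)%E ->
  (forall x x' : X,
     ((mdist x x')%:E <= connes B x x')%E /\
     (connes B x x' <= distortion (dens B) * (mdist x x')%:E)%E) /\
  (forall y y' : X, B (y, y') -> (mdist y y')%:E = connes B y y').
Proof.
move=> _ Bd Bs _ D2; split=> [x x'|y y' Byy'].
  by split; [exact: mdist_le_connes|exact: connes_le_distortion].
by apply/eqP; rewrite eq_le mdist_le_connes//= connes_le_mdist.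
Qed.
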